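(* Let $(X,d)$ be a compact metric space and let $f\colon X\to X$ be a homeomorphism. Suppose that there are $x,y\in X$ with $\mathcal{O}_f(x)\ne\mathcal{O}_f(y)$ and a closed subset $S$ of $X$ with $f(S)=S$ such that (1) $\{x,y\}\subset[W^u(S)\cap W^s(S)]\setminus S$, (2) $\liminf_{i\to-\infty}d(f^i(x),f^i(y))=\liminf_{i\to+\infty}d(f^i(x),f^i(y))=0$, (3) $f|_S\colon S\to S$ is chain transitive, (4) $f$ has shadowing on $S\cup\mathcal{O}_f(x)\cup\mathcal{O}_f(y)$. Then $f$ is Bohr chaotic.
   Context: For a homeomorphism $f\colon X\to X$ of a compact metric space $(X,d)$ and $x\in X$, $\mathcal{O}_f(x)=\{f^i(x)\colon i\in\mathbb{Z}\}$ is the (two-sided) orbit of $x$. For $x\in X$ and $S\subset X$, $d(x,S)=\inf_{s\in S}d(x,s)$ (with $\inf\emptyset=+\infty$). For a closed set $S\subset X$ with $f(S)=S$: $W^u(S)=\{x\in X\colon\lim_{i\to-\infty}d(f^i(x),S)=0\}$ and $W^s(S)=\{x\in X\colon\lim_{i\to+\infty}d(f^i(x),S)=0\}$. Shadowing on a subset: for $\delta>0$, a sequence $(x_i)_{i\in\mathbb{Z}}$ in $X$ is a $\delta$-pseudo orbit of $f$ if $\sup_{i\in\mathbb{Z}}d(f(x_i),x_{i+1})\le\delta$; it is $\epsilon$-shadowed by $x\in X$ if $\sup_{i\in\mathbb{Z}}d(x_i,f^i(x))\le\epsilon$. For a subset $S\subset X$, $f$ has shadowing on $S$ if for any $\epsilon>0$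 there is $\delta>0$ such that every $\delta$-pseudo orbit $(x_i)_{i\in\mathbb{Z}}$ of $f$ with $x_i\in S$ for all $i\in\mathbb{Z}$ is $\epsilon$-shadowed by some $x\in X$ (the shadowing point need not lie in $S$). Chain transitivity: a finite sequence $(x_i)_{i=0}^k$, $k\ge1$, is a $\delta$-chain of a homeomorphism $g\colon Z\to Z$ of a compact metric space if $d(g(x_i),x_{i+1})\le\delta$ for all $0\le i\le k-1$. $g$ is chain transitive if for any $x,y\in Z$ and $\delta>0$ there is a $\delta$-chain $(x_i)_{i=0}^k$ of $g$ with $x_0=x$ and $x_k=y$. Bohr chaos: let $C(X)$ be the set of continuous real-valued functions on $X$. A continuous map $f\colon X\to X$ is Bohr chaotic if for every bounded sequence $(a_i)_{i\ge0}$ of real numbers with $\limsup_{n\to\infty}\frac1n\sum_{i=0}^{n-1}|a_i|>0$ there are $x\in X$ and $\phi\in C(X)$ with $\limsup_{n\to\infty}\frac1n\left|\sum_{i=0}^{n-1}a_i\phi(f^i(x))\right|>0$. *)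

(* Defs.v *)
From mathcomp Require Import all_boot all_order all_algebra.
From mathcomp Require Import all_classical all_reals all_analysis.

Set Implicit Arguments.
Unset Strict Implicit.
Unset Printing Implicit Defensive.

Import Order.TTheory GRing.Theory Num.Theory.
Import numFieldNormedType.Exports.

Local Open Scope classical_set_scope.
Local Open Scope ring_scope.

(* The inverse is part of the data so that negative iterates can be computed;
   it is uniquely determined by the underlying map. *)
Record homeo (X : topologicalType) := Homeo {
  homeo_fun :> X -> X ;
  homeo_inv : X -> X ;
  homeo_funK : cancel homeo_fun homeo_inv ;
  homeo_invK : cancel homeo_inv homeo_fun ;
  homeo_fun_continuous : continuous homeo_fun ;
  homeo_inv_continuous : continuous homeo_inv }.

(* [Negz n] stands for the integer - n.+1. *)
Definition ziter (X : topologicalType) (f : homeo X) (i : int) (x : X) : X :=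
  match i with
  | Posz n => iter n f x
  | Negz n => iter n.+1 (homeo_inv f) x
  end.

Definition zorbit (X : topologicalType) (f : homeo X) (x : X) : set X :=
  range (fun i : int => ziter f i x).

Section metric.
Context {R : realType} {X : metricType R}.
Implicit Types (f : homeo X) (x y : X) (S : set X).

(* Extended-real valued, so that the distance to the empty set is +oo. *)
Definition set_dist x S : \bar R := ereal_inf [set (mdist x s)%:E | s in S].

Definition unstable_set f S : set X :=
  [set x | set_dist (ziter f (- n%:Z) x) S @[n --> \oo] --> 0%E].

Definition stable_set f S : set X :=
  [set x | set_dist (ziter f n%:Z x) S @[n --> \oo] --> 0%E].

Definition pseudo_orbit f (delta : R) (u : int -> X) : Prop :=
  forall i : int, mdist (f (u i)) (u (i + 1)) <= delta.

Definition shadowed f (eps : R) (u : int -> X) x : Prop :=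
  forall i : int, mdist (u i) (ziter f i x) <= eps.

(* The shadowing point is not required to belong to S. *)
Definition shadowing_on f S : Prop :=
  forall eps : R, 0 < eps -> exists2 delta : R, 0 < delta &
    forall u : int -> X, pseudo_orbit f delta u -> (forall i, S (u i)) ->
      exists x, shadowed f eps u x.

(* A finite sequence u 0, ..., u k is encoded by the first k.+1 values of a
   function on nat; the remaining values are irrelevant. *)
Definition is_chain (g : X -> X) (delta : R) (k : nat) (u : nat -> X) : Prop :=
  (0 < k)%N /\ forall i, (i < k)%N -> mdist (g (u i)) (u i.+1) <= delta.

(* Chain transitivity of the restriction of g to the invariant set S, viewed as
   a self-map of the metric subspace S: all the points of a chain lie in S. *)
Definition chain_transitive_on (g : X -> X) S : Prop :=
  forall x y, S x -> S y -> forall delta : R, 0 < delta ->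
    exists (k : nat) (u : nat -> X),
      [/\ is_chain g delta k u, forall i, (i <= k)%N -> S (u i),
          u 0%N = x & u k = y].

End metric.

(* In both averages the term n = 0 is 0^-1 * 0 = 0; it does not affect the
   upper limits. *)
Definition bohr_chaotic (R : realType) (X : topologicalType) (f : X -> X) : Prop :=
  forall a : nat -> R, bounded_fun a ->
    (0 < limn_esup (fun n => (n%:R^-1 * \sum_(i < n) `|a i|)%:E))%E ->
    exists (x : X) (phi : X -> R), continuous phi /\
      (0 < limn_esup
         (fun n => (n%:R^-1 * `|\sum_(i < n) a i * phi (iter i f x)|)%:E))%E.

(* Main.v *)
(* Because the orbits of x and y are proximal in both directions, one can follow
   either of them between two common neighbourhoods of points of S for the same
   number of steps, and return through S along a common chain. This gives two
   pseudo-orbit segments of equal length m that can be concatenated in any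
   order, only the first of which passes through x, and does so exactly once.
   As x is isolated in the union of S and the two orbits, a bump function phi
   at x takes the values 0 and 1 only along the points shadowing such
   concatenations; hence any set of times inside one residue class mod m is
   the set of times at which phi is 1 along some orbit. Given a sequence (a_i)
   whose absolute averages do not tend to 0, the pigeonhole principle yields a
   residue class and a sign such that the a_i of that sign in that class
   already have nonvanishing averages, and these times are selected. *)
Require Import Defs.
From mathcomp Require Import all_boot all_order all_algebra.
From mathcomp Require Import all_classical all_reals all_analysis.
From mathcomp Require Import zify lra.

Import Order.TTheory GRing.Theory Num.Theory.
Import numFieldNormedType.Exports.

Local Open Scope classical_set_scope.
Local Open Scope ring_scope.

(** * Upper and lower limits of real sequences *)

Lemma limn_esup_gt0P (R : realType) (u : nat -> R) :
  (0 < limn_esup (fun n => (u n)%:E))%E <->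
  exists2 c, 0 < c & forall N, exists2 n, (N <= n)%N & c <= u n.
Proof.
rewrite /limn_esup limf_esupE; split.
  set L := ereal_inf _ => L0.
  have [c c0 cL] : exists2 c : R, 0 < c & (c%:E < L)%E.
    case: L L0 => [r||]//.
    - rewrite lte_fin => r0; exists (r / 2); first lra.
      by rewrite lte_fin; lra.
    - by move=> _; exists 1 => //; rewrite ltey.
  exists c => // N.
  have : (c%:E < ereal_sup [set (u n)%:E | n in [set n | (N <= n)%N]])%E.
    apply: (lt_le_trans cL); apply: ereal_inf_lbound.
    by exists [set n | (N <= n)%N] => //; exact: nbhs_infty_ge.
  move=> /ereal_sup_gt[_ [n /= Nn <-]]; rewrite lte_fin => /ltW cu.
  by exists n.
move=> [c c0 cu]; apply: (@lt_le_trans _ _ c%:E); first by rewrite lte_fin.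
apply: le_ereal_inf_tmp => _ [V [N _ NV] <-].
have [n Nn cun] := cu N.
apply: le_ereal_sup_tmp; exists (u n)%:E; last by rewrite lee_fin.
by exists n => //; apply: NV.
Qed.

Lemma limn_einf_eq0_lt (R : realType) (u : nat -> R) (e : R) (N : nat) :
  limn_einf (fun n => (u n)%:E) = 0%E -> 0 < e ->
  exists2 n, (N <= n)%N & u n < e.
Proof.
(* The lower limit is by definition minus the upper limit of the opposite sequence. *)
move=> /eqP; rewrite /limn_einf oppe_eq0 => /eqP u0 e0.
have : ((- e)%:E < ereal_sup [set (\- (fun n => (u n)%:E))%E n |
    n in [set n | (N <= n)%N]])%E.
  apply: (@lt_le_trans _ _ 0%E); first by rewrite lte_fin oppr_lt0.
  rewrite -u0; apply: ereal_inf_lbound.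
  by exists [set n | (N <= n)%N] => //; exact: nbhs_infty_ge.
move=> /ereal_sup_gt[_ [n /= Nn <-]].
by rewrite lte_fin ltrN2 => ?; exists n.
Qed.

Lemma limn_esup_sum_gt0 (R : realType) (I : finType) (u : I -> nat -> R) :
  (0 < limn_esup (fun n => (\sum_i u i n)%:E))%E ->
  exists i, (0 < limn_esup (fun n => (u i n)%:E))%E.
Proof.
move=> /limn_esup_gt0P[c c0 cu]; apply: contrapT => /forallNP nu.
(* If every summand were eventually below [c'], the sum would eventually be below [c]; the successor
   makes this strict and covers an empty [I]. *)
pose c' := c / #|I|.+1%:R.
have c'0 : 0 < c' by rewrite divr_gt0.
have /choice[N uN] (i : I) :
    exists N, forall n, (N <= n)%N -> u i n < c'.
  apply: contrapT => /forallNP iN; apply: (nu i).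
  apply/limn_esup_gt0P; exists c' => // N.
  have /existsNP[n /not_implyP[Nn /negP]] := iN N.
  by rewrite -leNgt => ?; exists n.
have [n Nn] := cu (\max_i N i).
apply/negP; rewrite -ltNge.
apply: (@le_lt_trans _ _ (\sum_(i : I) c')).
  by apply: ler_sum => i _; apply/ltW/uN/(leq_trans _ Nn)/leq_bigmax.
rewrite sumr_const -mulr_natl /c' mulrCA gtr_pMr//.
by rewrite ltr_pdivrMr// mul1r ltr_nat.
Qed.

(** * Integer iterates and orbits *)

Lemma ziterD (X : topologicalType) (f : homeo X) (i j : int) (x : X) :
  ziter f (i + j) x = ziter f i (ziter f j x).
Proof.
have zS k w : ziter f (k + 1) w = f (ziter f k w).
  case: k => [n|[|n]]; first by rewrite -PoszD addn1.
    by rewrite /= homeo_invK.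
  rewrite (_ : Negz n.+1 + 1 = Negz n); last by rewrite !NegzE; lia.
  by rewrite /= homeo_invK.
have zP k w : ziter f (k - 1) w = homeo_inv f (ziter f k w).
  by rewrite -{2}(subrK 1 k) zS homeo_funK.
elim: i => [|n ih|n ih]; first by rewrite add0r.
  by rewrite -addn1 PoszD addrAC !zS ih.
by rewrite -addn1 PoszD opprD addrAC !zP ih.
Qed.

Lemma ziter_periodic (X : topologicalType) (f : homeo X) (i : int) (x : X) :
  ziter f i x = x -> forall k : nat, ziter f (i * k) x = x.
Proof.
move=> xx; elim => [|k ih]; first by rewrite mulr0.
by rewrite -addn1 PoszD mulrDr mulr1 ziterD xx.
Qed.

Lemma zorbit_eq (X : topologicalType) (f : homeo X) (x y : X) (i j : int) :
  ziter f i x = ziter f j y -> zorbit f x = zorbit f y.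
Proof.
move=> xy; have {xy} -> : x = ziter f (- i + j) y.
  by rewrite ziterD -xy -ziterD addNr.
rewrite seteqP; split=> _ [k _ <-].
  by rewrite -ziterD; exists (k + (- i + j)).
by exists (k - (- i + j)) => //; rewrite -ziterD subrK.
Qed.

(** * Isolation of points homoclinic to [S] *)

Section metric.
Context {R : realType} {X : metricType R} {f : homeo X}.
Implicit Types (x y : X) (S : set X).

Lemma set_dist_cvg0_near (g : nat -> X) S (e : R) :
  set_dist (g n) S @[n --> \oo] --> 0%E -> 0 < e ->
  exists N, forall n, (N <= n)%N -> exists2 s, S s & mdist (g n) s < e.
Proof.
move=> g0 e0.
have [N _ gN] : \forall n \near \oo, (set_dist (g n) S < e%:E)%E.
  by apply: (g0 [set u | (u < e%:E)%E]); apply: open_ereal_lt'; rewrite lte_fin.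
exists N => n /gN /ereal_inf_lt[_ [s Ss <-]].
by rewrite lte_fin; exists s.
Qed.

Lemma closed_mdist_lbound x S : closed S -> ~ S x ->
  exists2 e : R, 0 < e & forall s, S s -> e <= mdist x s.
Proof.
move=> clS Sx; have : nbhs x (~` S).
  by apply: open_nbhs_nbhs; split => //; exact: closed_openC.
move=> /nbhs_ballP[e /= e0 eS]; exists e => // s Ss.
rewrite leNgt; apply/negP => xs; apply: (eS s) => //.
by rewrite ballEmdist.
Qed.

Lemma mdist_seq_lbound x (g : nat -> X) (N : nat) :
  exists2 e : R, 0 < e & forall n, (n < N)%N -> g n <> x -> e <= mdist x (g n).
Proof.
elim: N => [|N [e e0 eN]]; first by exists 1.
have [gx|/eqP gx] := pselect (g N = x).
  by exists e => // n; rewrite ltnS leq_eqVlt => /predU1P[->//|/eN].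
exists (Num.min e (mdist x (g N))).
  by rewrite lt_min e0 mdist_gt0 eq_sym.
move=> n; rewrite ltnS leq_eqVlt => /predU1P[->|/eN en /en].
  by rewrite ge_min lexx orbT.
by rewrite ge_min => ->.
Qed.

(** Both ends of the orbit of [y] approach [S], which stays away from [x], so only finitely many
    iterates can come near [x]. The case [y = x] isolates [x] in its own orbit. *)
Lemma homoclinic_lbound x y S : closed S -> ~ S x ->
  unstable_set f S y -> stable_set f S y ->
  exists2 e : R, 0 < e &
    forall i, ziter f i y <> x -> e <= mdist x (ziter f i y).
Proof.
move=> clS Sx uy sy; have [r r0 rS] := closed_mdist_lbound x S clS Sx.
have tail (g : nat -> X) : set_dist (g n) S @[n --> \oo] --> 0%E ->
    exists2 e : R, 0 < e & forall n, g n <> x -> e <= mdist x (g n).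
  move=> /(set_dist_cvg0_near g S (r / 2))[]; first by rewrite divr_gt0.
  move=> N gN; have [e e0 eN] := mdist_seq_lbound x g N.
  exists (Num.min e (r / 2)); first by rewrite lt_min e0 divr_gt0.
  move=> n gx; have [nN|Nn] := ltnP n N; first by rewrite ge_min eN.
  have [s Ss gs] := gN n Nn.
  rewrite ge_min; apply/orP; right.
  by have := rS s Ss; have := metric_triangle x (g n) s; lra.
have [e1 e10 h1] := tail _ uy.
have [e2 e20 h2] := tail _ sy.
exists (Num.min e1 e2) => [|i ix]; first by rewrite lt_min e10.
rewrite ge_min; apply/orP.
case: i ix => n ix; [right; exact: h2|left].
by rewrite NegzE in ix *; exact: h1.
Qed.

(** A periodic orbit would return to [x] at arbitrarily late times, when it must already be close to
    [S]. *)
Lemma homoclinic_not_periodic x S (i : int) : closed S -> ~ S x ->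
  unstable_set f S x -> stable_set f S x -> ziter f i x = x -> i = 0.
Proof.
move=> clS Sx ux sx ix; apply: contrapT => i0.
have [r r0 rS] := closed_mdist_lbound x S clS Sx.
have per (g : nat -> X) (n : nat) : set_dist (g n) S @[n --> \oo] --> 0%E ->
    (0 < n)%N -> (forall k, g (n * k)%N = x) -> False.
  move=> /(set_dist_cvg0_near g S r)/(_ r0)[N gN] n0 gx.
  have [|s /rS] := gN (n * N)%N; first by rewrite leq_pmull.
  by rewrite gx; lra.
have ixk := ziter_periodic _ _ _ _ ix.
case: i ix i0 ixk => n ix i0 ixk.
  apply: (per _ n sx) => [|k].
    by rewrite lt0n; apply/eqP => n0; apply: i0; rewrite n0.
  by rewrite PoszM ixk.
apply: (per _ n.+1 ux) => // k.
by rewrite PoszM -mulNr -NegzE ixk.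
Qed.

(** * Bump functions, concatenated blocks and shadowing orbits *)

Lemma bump_function x (e : R) : 0 < e ->
  exists2 phi : X -> R, continuous phi &
    (forall w, mdist x w <= e -> phi w = 1) /\
    (forall w, 2 * e <= mdist x w -> phi w = 0).
Proof.
(* Affine in the distance to [x], equal to 1 at distance [e] and to 0 at [2 * e]; clipping to [0, 1]
   gives the bump. *)
move=> e0; pose psi (w : X) := 2 - e^-1 * mdist x w.
exists (cst 0 \max (cst 1 \min psi)).
  have cd : continuous (mdist x : X -> R).
    move=> w; apply/cvgrPdist_lt => d d0.
    apply/nbhs_ballP; exists d => // v; rewrite ballEmdist /=.
    have := metric_triangle x w v; have := metric_triangle x v w.
    rewrite (metric_sym v w) ltr_norml => ? ? ?; apply/andP; split; lra.
  have cpsi : continuous psi.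
    move=> w; apply: cvgB; first exact: cvg_cst.
    by apply: cvgM; [exact: cvg_cst|exact: cd].
  apply: max_fun_continuous; first exact: cst_continuous.
  by apply: min_fun_continuous; [exact: cst_continuous|exact: cpsi].
split=> w; rewrite /psi /= => hw.
  have : e^-1 * mdist x w <= 1 by rewrite ler_pdivrMl ?mulr1.
  move=> h; rewrite min_l; first by rewrite max_r.
  lra.
have : 2 <= e^-1 * mdist x w by rewrite ler_pdivlMl// mulrC.
move=> h; rewrite max_l// ge_min; apply/orP; right; lra.
Qed.

(** The quotient by [m] picks the block and the remainder the position in it, so each step stays
    inside a block or goes from a last point to a first one. *)
Lemma pseudo_orbit_blocks (d : R) (m : nat) (B : bool -> nat -> X)
    (w : int -> bool) (s : int) : (0 < m)%N ->
  (forall b t, (t.+1 < m)%N -> mdist (f (B b t)) (B b t.+1) <= d) ->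
  (forall b b', mdist (f (B b m.-1)) (B b' 0%N) <= d) ->
  pseudo_orbit f d (fun i => B (w ((i + s) %/ m)%Z) `|((i + s) %% m)%Z|%N).
Proof.
move=> m0 Bin Bout i /=; rewrite addrAC; set k := i + s.
have m0' : m%:Z != 0 by rewrite eqz_nat -lt0n.
have := modz_ge0 k m0'; have := @ltz_pmod k m%:Z m0.
have := divz_eq k m; set q := (k %/ m)%Z; set r := (k %% m)%Z.
case: r => // r kE; rewrite ltz_nat => rm _.
have [rm1|mr] := ltnP r.+1 m.
  have kE1 : k + 1 = q * m + r.+1 by rewrite kE -addrA -PoszD addn1.
  rewrite kE1 divzMDl// modzMDl divz_small ?addr0; last by rewrite /= ltz_nat.
  by rewrite modz_small ?ltz_nat//; exact: Bin.
have rE : r.+1 = m by apply/eqP; rewrite eqn_leq rm.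
have kE1 : k + 1 = (q + 1) * m + 0.
  by rewrite kE -addrA -PoszD addn1 rE mulrDl mul1r addr0.
by rewrite kE1 modzMDl mod0z /= (_ : r = m.-1) ?Bout// -rE.
Qed.

(* The orbit segments f^-N x, ..., f^(M-1) x and f^-N y, ..., f^(M-1) y, each
   followed by the same chain in S, are two blocks of equal length. *)
Lemma interchangeable_blocks x y S (d : R) :
  zorbit f x <> zorbit f y -> closed S ->
  [set x; y] `<=` (unstable_set f S `&` stable_set f S) `\` S ->
  limn_einf (fun n : nat =>
    (mdist (ziter f (- n%:Z) x) (ziter f (- n%:Z) y))%:E) = 0%E ->
  limn_einf (fun n : nat =>
    (mdist (ziter f n%:Z x) (ziter f n%:Z y))%:E) = 0%E ->
  chain_transitive_on f S -> 0 < d ->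
  exists (m N : nat) (B : bool -> nat -> X), (N < m)%N /\
    [/\ forall b t, (t.+1 < m)%N -> mdist (f (B b t)) (B b t.+1) <= d,
        forall b b', mdist (f (B b m.-1)) (B b' 0%N) <= d,
        forall b t, (t < m)%N -> (S `|` zorbit f x `|` zorbit f y) (B b t) &
        forall b t, (t < m)%N -> B b t = x <-> b && (t == N)].
Proof.
move=> xy clS xyS xyu xys chS d0.
have [[ux sx] Sx] := xyS x (or_introl erefl).
(* The worst junction has three errors: the last jump of the chain to [s], from [s] to the orbit of
   [x], and from there to the orbit of [y]. *)
have d30 : 0 < d / 3 by rewrite divr_gt0.
have [N [s Ss [xs xyN]]] : exists (N : nat), exists2 s, S s &
    mdist (ziter f (- N%:Z) x) s < d / 3 /\
    mdist (ziter f (- N%:Z) x) (ziter f (- N%:Z) y) < d / 3.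
  have [N0 N0S] := set_dist_cvg0_near _ S _ ux d30.
  have [N N0N ?] := limn_einf_eq0_lt _ _ _ N0 xyu d30.
  by exists N; have [s Ss ?] := N0S N N0N; exists s.
have [M M0 [s' Ss' [xs' xyM]]] : exists2 M : nat, (0 < M)%N & exists2 s, S s &
    mdist (ziter f M x) s < d / 3 /\
    mdist (ziter f M x) (ziter f M y) < d / 3.
  have [N0 N0S] := set_dist_cvg0_near _ S _ sx d30.
  (* Requiring [M >= 1] makes each orbit segment contain time 0, hence the point [x] itself. *)
  have [M] := limn_einf_eq0_lt _ _ _ (maxn 1 N0) xys d30.
  rewrite geq_max => /andP[M0 N0M] ?.
  by exists M => //; have [s1 Ss1 ?] := N0S M N0M; exists s1.
have [k [c [[k0 fc] Sc c0 ck]]] := chS s' s Ss' Ss _ d30.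
pose p (b : bool) := if b then x else y.
have exitS b : mdist (ziter f M (p b)) s' <= d.
  case: b; rewrite /p; first by lra.
  have := metric_triangle (ziter f M y) (ziter f M x) s'.
  by rewrite (metric_sym (ziter f M y) (ziter f M x)); lra.
have enterS b : mdist s (ziter f (- N%:Z) (p b)) <= 2 * (d / 3).
  case: b; rewrite /p; first by rewrite metric_sym; lra.
  have := metric_triangle s (ziter f (- N%:Z) x) (ziter f (- N%:Z) y).
  by rewrite (metric_sym s (ziter f (- N%:Z) x)); lra.
pose l := (N + M)%N.
have Nl : (N < l)%N by rewrite /l -[X in (X < _)%N]addn0 ltn_add2l.
(* Position [N] is time 0. The endpoint [s] of the chain is omitted: the next block starts in its
   place. *)
pose B b t := if (t < l)%N then ziter f (t%:Z - N%:Z) (p b) else c (t - l)%N.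
have fz i w : f (ziter f i w) = ziter f (i + 1) w by rewrite addrC ziterD.
have t1N t : t%:Z - N%:Z + 1 = t.+1%:Z - N%:Z by rewrite addrAC -PoszD addn1.
exists (l + k)%N, N, B; split; first exact: ltn_addr.
have ck1 t : (t < l + k)%N -> (l <= t)%N -> (t - l < k)%N.
  by move=> tm lt; rewrite ltn_subLR.
split.
- move=> b t tm; rewrite /B; have [tl|lt|tl] := ltngtP t.+1 l.
  + by rewrite fz t1N mdistxx ltW.
  + by rewrite subSn//; have := fc _ (ck1 t (ltnW tm) lt); lra.
  + rewrite fz t1N tl subnn c0 (_ : l%:Z - N%:Z = M) ?exitS//.
    by rewrite PoszD addrAC subrr add0r.
- move=> b b'.
  rewrite /B (leq_ltn_trans (leq0n N) Nl) sub0r -(prednK k0) addnS /=.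
  rewrite ltnNge leq_addr /= addKn.
  have := fc k.-1; rewrite prednK// leqnn ck => /(_ isT) fk.
  have := metric_triangle (f (c k.-1)) s (ziter f (- N%:Z) (p b')).
  by have := enterS b'; lra.
- move=> b t tm; rewrite /B; case: ltnP => tl.
    by case: b => /=; [left; right|right]; exists (t%:Z - N%:Z).
  by left; left; apply/Sc/ltnW/ck1.
(* The chain lies in [S], the orbit of [y] avoids [x], and [x] is not periodic, so [x] occurs only
   at position [N] of the block of [x]. *)
- move=> b t tm; split.
    rewrite /B; case: ltnP => tl; last first.
      by move=> cx; exfalso; apply: Sx; rewrite -cx; apply/Sc/ltnW/ck1.
    case: b => [|ty]; last first.
      by exfalso; apply: xy; apply: (zorbit_eq _ _ _ _ 0 (t%:Z - N%:Z)).
    move=> /(homoclinic_not_periodic x S _ clS Sx ux sx)/eqP.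
    by rewrite subr_eq0 eqz_nat.
  by case: b => //= /eqP ->; rewrite /B Nl subrr.
Qed.

Lemma selecting_orbits x y S :
  zorbit f x <> zorbit f y -> closed S ->
  [set x; y] `<=` (unstable_set f S `&` stable_set f S) `\` S ->
  limn_einf (fun n : nat =>
    (mdist (ziter f (- n%:Z) x) (ziter f (- n%:Z) y))%:E) = 0%E ->
  limn_einf (fun n : nat =>
    (mdist (ziter f n%:Z x) (ziter f n%:Z y))%:E) = 0%E ->
  chain_transitive_on f S ->
  shadowing_on f (S `|` zorbit f x `|` zorbit f y) ->
  exists (phi : X -> R) (m : nat), [/\ continuous phi, (0 < m)%N &
    forall (E : nat -> bool) (j : nat), (j < m)%N ->
      (forall i, E i -> (i %% m)%N = j) ->
      exists z, forall i, phi (iter i f z) = (E i)%:R].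
Proof.
move=> xy clS xyS xyu xys chS shS; set T := (X in shadowing_on f X) in shS.
have [[ux sx] Sx] := xyS x (or_introl erefl).
have [[uy sy] _] := xyS y (or_intror erefl).
have [r r0 rS] := closed_mdist_lbound x S clS Sx.
have [r1 r10 r1x] := homoclinic_lbound x x S clS Sx ux sx.
have [r2 r20 r2y] := homoclinic_lbound x y S clS Sx uy sy.
(* Points of [T] other than [x] are at least [3 * e] from [x]; after a shadowing error [e] they
   remain at least [2 * e] away, where [phi] vanishes. *)
pose e := Num.min r (Num.min r1 r2) / 3.
have e0 : 0 < e by rewrite divr_gt0// !lt_min r0 r10.
have sep w : T w -> w <> x -> 3 * e <= mdist x w.
  rewrite /e mulrC divfK// !ge_min => -[[Sw _|[i _ <-] ix]|[i _ <-] ix].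
  - by rewrite rS.
  - by rewrite r1x ?orbT.
  - by rewrite r2y ?orbT.
have [phi cphi [phi1 phi0]] := bump_function x e e0.
have [d d0 shd] := shS e e0.
have [m [N [B [Nm [Bin Bout BT Bx]]]]] :=
  interchangeable_blocks x y S d xy clS xyS xyu xys chS d0.
have m0 : (0 < m)%N by rewrite (leq_ltn_trans _ Nm).
exists phi, m; split=> // E j jm Ej.
(* Block [q] follows [x] exactly when its only candidate time [q * m + j] is in [E]; blocks of
   negative index follow [y]. *)
pose w (q : int) := if q is Posz n then E (n * m + j)%N else false.
(* The shift by [N - j] puts time [q * m + j] at position [N] of block [q]. *)
pose u i := B (w ((i + (N%:Z - j%:Z)) %/ m)%Z)
              `|((i + (N%:Z - j%:Z)) %% m)%Z|%N.
have m0' : m%:Z != 0 by rewrite eqz_nat -lt0n.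
have uT i : T (u i).
  by apply: BT; rewrite -ltz_nat gez0_abs ?modz_ge0// ltz_pmod.
have [||z zu] := shd u; [exact: pseudo_orbit_blocks|exact: uT|].
exists z => i; have {zu} ui : mdist (u i) (iter i f z) <= e by exact: (zu i).
have uE : u i = x <-> E i.
  rewrite /u Bx; last by rewrite -ltz_nat gez0_abs ?modz_ge0// ltz_pmod.
  have shift (q : nat) :
      i%:Z + (N%:Z - j%:Z) = q%:Z * m%:Z + N -> i = (q * m + j)%N.
    by clear; lia.
  split=> [/andP[]|Ei].
    move: (divz_eq (i%:Z + (N%:Z - j%:Z)) m) (modz_ge0 (i%:Z + (N%:Z - j%:Z)) m0').
    case: (_ %/ _)%Z => // q + r0' /= Eq /eqP rN.
    by rewrite -(gez0_abs r0') rN => /shift ->.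
  have -> : i%:Z + (N%:Z - j%:Z) = (i %/ m)%N%:Z * m%:Z + N.
    by rewrite {1}(divn_eq i m) Ej// PoszD PoszM addrACA subrr addr0.
  rewrite divzMDl// modzMDl divz_small ?ltz_nat// modz_small ?ltz_nat//.
  by rewrite addr0 /= eqxx andbT -(Ej i Ei) -divn_eq.
have [Ei|/negP Ei] := boolP (E i).
  by apply: phi1; rewrite -{1}(uE.2 Ei).
apply: phi0.
have := sep _ (uT i) (fun h => Ei (uE.1 h)).
have := metric_triangle x (iter i f z) (u i).
by rewrite (metric_sym (iter i f z) (u i)); lra.
Qed.

End metric.

(** * Selection of times by residue class and sign *)

Theorem theorem1 (R : realType) (X : metricType R) (f : homeo X)
    (x y : X) (S : set X) :
  compact [set: X] ->
  zorbit f x <> zorbit f y ->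
  closed S ->
  f @` S = S ->
  [set x; y] `<=` (unstable_set f S `&` stable_set f S) `\` S ->
  limn_einf (fun n : nat =>
    (mdist (ziter f (- n%:Z) x) (ziter f (- n%:Z) y))%:E) = 0%E ->
  limn_einf (fun n : nat =>
    (mdist (ziter f n%:Z x) (ziter f n%:Z y))%:E) = 0%E ->
  chain_transitive_on f S ->
  shadowing_on f (S `|` zorbit f x `|` zorbit f y) ->
  bohr_chaotic R f.
Proof.
move=> _ xy clS _ xyS xyu xys chS shS a _ a0.
have [phi [m [cphi m0 sel]]] := selecting_orbits x y S xy clS xyS xyu xys chS shS.
(* The value [true] of [jb.2] selects the negative terms, [false] the positive ones. *)
pose E (jb : 'I_m * bool) i := ((i %% m)%N == jb.1) && (0 < (-1) ^+ jb.2 * a i).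
have [[j b] jb0] : exists jb, (0 < limn_esup (fun n =>
    (n%:R^-1 * \sum_(i < n) (E jb i)%:R * `|a i|)%:E))%E.
  (* Every nonzero [a i] belongs to exactly one of these finitely many classes, so the class
     averages add up to the average of the absolute values. *)
  apply: limn_esup_sum_gt0; move: a0; congr (0 < limn_esup _)%E.
  apply/funext => n; rewrite -mulr_sumr exchange_big /=; congr (_ * _)%:E.
  apply: eq_bigr => i _; rewrite -mulr_suml.
  have [->|ai0] := eqVneq (a i) 0; first by rewrite normr0 mulr0.
  have im : (i %% m < m)%N by rewrite ltn_mod.
  rewrite (bigD1 (Ordinal im, a i < 0)) //= big1 => [|[j b] /eqP jb].
    rewrite /E /= eqxx addr0 /=.
    have [ai|ai|ai] := ltgtP (a i) 0; last by rewrite ai eqxx in ai0.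
    - by rewrite mulN1r oppr_gt0 ai mul1r.
    - by rewrite mul1r ai mul1r.
  rewrite /E /=; case: eqP => //= ij; case: ltP => // ab; exfalso; apply: jb.
  congr (_, _); first exact/val_inj.
  case: b ab => /=; first by rewrite mulN1r oppr_gt0 => ->.
  by rewrite mul1r => ai; rewrite ltNge ltW.
have [i /andP[/eqP]//|z phiz] := sel (E (j, b)) j (ltn_ord j).
exists z, phi; split => //; move: jb0; congr (0 < limn_esup _)%E.
apply/funext => n; congr (_ * _)%:E.
(* All selected terms have the sign [(-1) ^+ b], so no cancellation occurs in their sum. *)
rewrite -[LHS]ger0_norm; last by apply: sumr_ge0 => i _; rewrite mulr_ge0.
rewrite -[RHS](normrMsign b) mulr_sumr; congr `|_|; apply: eq_bigr => i _.
rewrite phiz; have [/andP[_ ai]|_] := boolP (E (j, b) i).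
  by rewrite mul1r mulr1 -(normrMsign b) gtr0_norm.
by rewrite mul0r !mulr0.
Qed.
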